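(* The complete graph $K_7$ on seven vertices does not have property ( * ).
   Context: All graphs are finite, undirected, and simple. An anticlique is a set of pairwise nonadjacent vertices. A coloring of a graph $G$ is a partition $\mathfrak{C}$ of $V(G)$ into anticliques (nonempty, called color classes). A transversal of $\mathfrak{C}$ is a set $T$ containing exactly one element of each member of $\mathfrak{C}$ and nothing else. A Kempe chain is a connected component of $G[A\cup B]$ for some $A\neq B$ from $\mathfrak{C}$. The routing graph $H(G,\mathfrak{C},T)$ is the graph on vertex set $T$ in which two distinct $s,t\in T$ are adjacent if and only if they belong to the same Kempe chain in $G$ (equivalently, there is an $s$,$t$-path in $G[A\cup B]$ where $A,B\in\mathfrak{C}$ are the classes containing $s,t$). For a graph $H$ with $V(H)\subseteq V(G)$, a rooted $H$-certificate in $G$ is a family $(V_t)_{t\in V(H)}$ of pairwise disjoint subsets of $V(G)$ (bags) such that $t\in V_t$ and $G[V_t]$ is connected for all $t\in V(H)$, and for every $st\in E(H)$ there is an edge of $G$ connecting $V_s$ and $V_t$. A graph $K$ has property ( * ) if for every graph $G$, every coloring $\mathfrak{C}$ of $G$ with $|\mathfrak{C}|=|V(K)|$, every transversal $T$ of $\mathfrak{C}$, and every spanning subgraph $H$ of $H(G,\mathfrak{C},T)$ isomorphic to $K$, there exists a rooted $H$-certificate in $G$. *)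

(* Defs.v *)
From mathcomp Require Import all_boot.

Set Implicit Arguments.
Unset Strict Implicit.
Unset Printing Implicit Defensive.

Record graph (V : finType) := Graph {
  adj :> rel V;
  adj_sym : symmetric adj;
  adj_irrefl : irreflexive adj
}.

Lemma complete_sym (n : nat) : symmetric [rel i j : 'I_n | i != j].
Proof. by move=> i j; rewrite /= eq_sym. Qed.

Lemma complete_irrefl (n : nat) : irreflexive [rel i j : 'I_n | i != j].
Proof. by move=> i; rewrite /= eqxx. Qed.

Definition complete_graph (n : nat) : graph 'I_n :=
  Graph (@complete_sym n) (@complete_irrefl n).

Definition isomorphic (U W : finType) (H : graph U) (K : graph W) : Prop :=
  exists2 f : U -> W, bijective f & forall x y, K (f x) (f y) = H x y.

Definition spanning_subgraph (V : finType) (H G : graph V) : Prop :=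
  subrel H G.

Section Notions.
Variables (V : finType) (G : graph V).

Definition anticlique (A : {set V}) : Prop := {in A &, forall x y, ~~ G x y}.

(* [partition] already requires the classes to be nonempty. *)
Definition coloring (C : {set {set V}}) : Prop :=
  partition C [set: V] /\ {in C, forall A, anticlique A}.

(* The edges of G[S], kept as a relation on the whole of V; vertices outside S
   are isolated for it. *)
Definition induced (S : {set V}) : rel V :=
  [rel x y | [&& x \in S, y \in S & G x y]].

Definition components (S : {set V}) : {set {set V}} :=
  equivalence_partition (connect (induced S)) S.

(* The empty set counts as connected; bags are nonempty as they contain
   their root. *)
Definition connected (S : {set V}) : Prop :=
  {in S &, forall x y, connect (induced S) x y}.

Definition kempe_chain (C : {set {set V}}) (X : {set V}) : bool :=
  [exists A in C, exists B in C, (A != B) && (X \in components (A :|: B))].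

Definition routing_adj (C : {set {set V}}) (T : {set V}) :
    rel {t : V | t \in T} :=
  [rel s t | (s != t) &&
     [exists X : {set V}, [&& kempe_chain C X, val s \in X & val t \in X]]].

Lemma routing_adj_sym C T : symmetric (@routing_adj C T).
Proof.
move=> s t; rewrite /routing_adj /= eq_sym; congr (_ && _).
by apply: eq_existsb => X; congr (_ && _); rewrite andbC.
Qed.

Lemma routing_adj_irrefl C T : irreflexive (@routing_adj C T).
Proof. by move=> s; rewrite /routing_adj /= eqxx. Qed.

Definition routing_graph (C : {set {set V}}) (T : {set V}) :
    graph {t : V | t \in T} :=
  Graph (@routing_adj_sym C T) (@routing_adj_irrefl C T).

(* A graph H with V(H) = U, U a subset of V(G), is a graph on the subtype of
   the elements of U. *)
Definition rooted_certificate (U : {set V}) (H : graph {t : V | t \in U})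
    (bag : {t : V | t \in U} -> {set V}) : Prop :=
  [/\ forall s t, s != t -> [disjoint bag s & bag t],
      forall t, val t \in bag t,
      forall t, connected (bag t)
    & forall s t, H s t ->
        exists x y, [/\ x \in bag s, y \in bag t & G x y]].

End Notions.

Definition property_star (W : finType) (K : graph W) : Prop :=
  forall (V : finType) (G : graph V) (C : {set {set V}}) (T : {set V})
    (H : graph {t : V | t \in T}),
    coloring G C -> #|C| = #|W| ->
    is_transversal T C [set: V] ->
    spanning_subgraph H (routing_graph G C T) ->
    isomorphic H K ->
    exists bag, rooted_certificate G H bag.

(* Main.v *)
Require Import Defs.
From mathcomp Require Import all_boot.

(** A graph [Q] on a set [I] yields a graph [doubling Q] with two vertices per
    element [i] of [I], a root t_i and a copy v_i.  The pairs {t_i, v_i} are the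
    color classes and the roots form the transversal.  If [Q i j] fails then
    t_i t_j is an edge; if [Q i j] holds then t_i v_j, v_i v_j and v_i t_j are
    edges, so that t_i - v_j - v_i - t_j is a two-colored path.  Hence any two
    roots share a Kempe chain and the routing graph is complete
    ([routing_doubling]).

    A rooted certificate for the complete graph has one bag per root, and only
    the #|I| copies are available to enlarge these bags.  Let X_i be the set of
    copies in the bag of t_i.  Suppose that [Q] is triangle-free and that every
    nonempty anticlique S of [Q] has more than #|S| neighbors.  Let S be the set
    of the i with X_i empty.  If i is in S and j is a [Q]-neighbor of i, then
    X_j must contain some v_k with [Q i k]; as [Q] has no triangle, v_k is not
    adjacent to t_j, so X_j contains a second copy, through which v_k is
    reached.  So S is an anticlique whose neighbors all have bags with at least
    two copies, and counting copies gives #|N(S)| <= #|S|.  Hence S is empty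
    ([linkage_nonempty]), and every bag contains exactly one copy.  Thus the
    bags are the sets {t_i, v_(p i)} for a permutation [p] of [I] that moves
    each i along an edge of [Q] ([linkage_map]).

    Finally let [Q] be the theta graph made of the pentagon 0-1-2-3-4 and the
    path 0-5-6-2.  A permutation that moves points along edges decomposes [Q]
    into matched edges and directed cycles.  Since 7 is odd, it has an odd
    cycle; [Q] has no cycle of length 7, so that cycle is one of the two
    pentagons 0-1-2-3-4 and 0-1-2-6-5, and the two remaining vertices are
    swapped.  In the first case the bags of 0 and 5 are not adjacent, in the
    second case those of 0 and 4 ([theta_no_map]). *)

Set Implicit Arguments.
Unset Strict Implicit.
Unset Printing Implicit Defensive.

(** * Doubling a graph *)

Section Doubling.

Variables (I : finType) (Q : graph I).

Local Notation vertex := (bool * I)%type.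

(** The root t_i is encoded as [(false, i)] and the copy v_i as [(true, i)]. *)
Definition doubling_adj : rel vertex :=
  [rel x y | if x.1 || y.1 then Q x.2 y.2 else (x.2 != y.2) && ~~ Q x.2 y.2].

Lemma doubling_sym : symmetric doubling_adj.
Proof.
by move=> [[] i] [[] j]; rewrite /doubling_adj /= adj_sym // eq_sym.
Qed.

Lemma doubling_irrefl : irreflexive doubling_adj.
Proof.
by move=> [[] i]; rewrite /doubling_adj /= ?adj_irrefl ?eqxx.
Qed.

Definition doubling : graph vertex := Graph doubling_sym doubling_irrefl.

Definition fibre (i : I) : {set vertex} := [set x | x.2 == i].

Definition fibres : {set {set vertex}} := [set fibre i | i : I].

Definition roots : {set vertex} := [set x | ~~ x.1].

Lemma mem_fibre x i : (x \in fibre i) = (x.2 == i).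
Proof. by rewrite inE. Qed.

Lemma fibre_inj : injective fibre.
Proof.
by move=> i j /setP/(_ (true, i)); rewrite !mem_fibre /= eqxx => /esym/eqP.
Qed.

Lemma card_fibres : #|fibres| = #|I|.
Proof. by rewrite card_imset //; apply: fibre_inj. Qed.

Lemma fibres_partition : partition fibres [set: vertex].
Proof.
apply/and3P; split.
- rewrite eqEsubset subsetT /=; apply/subsetP=> x _; apply/bigcupP.
  by exists (fibre x.2); rewrite ?imset_f ?mem_fibre.
- apply/trivIsetP=> _ _ /imsetP[i _ ->] /imsetP[j _ ->] neq_ij.
  apply/pred0P=> x /=; rewrite !mem_fibre; apply/negP=> /andP[/eqP xi /eqP xj].
  by rewrite -xi -xj eqxx in neq_ij.
- apply/imsetP=> -[i _ /setP/(_ (true, i))].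
  by rewrite mem_fibre inE /= eqxx.
Qed.

Lemma fibres_coloring : coloring doubling fibres.
Proof.
split=> [|_ /imsetP[i _ ->] x y]; first exact: fibres_partition.
rewrite !mem_fibre => /eqP xi /eqP yi.
by rewrite /= /doubling_adj /= xi yi adj_irrefl eqxx if_same.
Qed.

Lemma roots_transversal : is_transversal roots fibres [set: vertex].
Proof.
apply/and3P; split; [exact: fibres_partition | exact: subsetT |].
apply/forall_inP=> _ /imsetP[i _ ->]; apply/cards1P; exists (false, i).
by apply/setP=> -[[] j]; rewrite !inE xpair_eqE.
Qed.

Lemma root_in i : (false, i) \in roots.
Proof. by rewrite inE. Qed.

Definition root i : {x | x \in roots} := exist _ (false, i) (root_in i).

Lemma rootK : cancel root (fun s => (val s).2).
Proof. by []. Qed.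

Lemma root_indexK : cancel (fun s : {x | x \in roots} => (val s).2) root.
Proof.
by move=> [[[] i] ri]; apply: val_inj => //=; move: ri; rewrite /= inE.
Qed.

(** The purpose of the copies: an edge of [Q] forbids the edge between the two
    roots, but provides a detour through both copies, in the same two colors. *)
Lemma roots_kempe_connected i j :
  i != j ->
  connect (induced doubling (fibre i :|: fibre j)) (false, i) (false, j).
Proof.
move=> neq_ij; have [Qij|nQij] := boolP (Q i j); last first.
  apply: connect1; rewrite /induced /= !inE /= !eqxx orbT /=.
  by rewrite /doubling_adj /= neq_ij.
apply/connectP; exists [:: (true, j); (true, i); (false, j)] => //=.
rewrite /induced /= !inE /= !eqxx !orbT /= /doubling_adj /=.
by rewrite (adj_sym Q j i) Qij.
Qed.

Lemma routing_doubling s t : routing_graph doubling fibres roots s t = (s != t).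
Proof.
rewrite /= /routing_adj /=.
have [//|neq_st] := eqVneq s t.
rewrite -(root_indexK s) -(root_indexK t) in neq_st *.
move: (val s).2 (val t).2 neq_st => i j neq_st.
have neq_ij : i != j by apply: contraNneq neq_st => ->.
pose S := fibre i :|: fibre j.
apply/existsP.
exists [set y in S | connect (induced doubling S) (false, i) y].
apply/and3P; split.
- apply/exists_inP; exists (fibre i); first exact: imset_f.
  apply/exists_inP; exists (fibre j); first exact: imset_f.
  rewrite (inj_eq fibre_inj) neq_ij.
  by apply: imset_f; rewrite !inE eqxx.
- by rewrite !inE eqxx connect0.
- by rewrite !inE eqxx orbT roots_kempe_connected.
Qed.

(** * Certificates in a doubling *)

(** What the argument uses of a certificate for the complete graph, in terms of
    the sets of copies in its bags: disjointness; connectedness, of which only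
    the first edge of a path out of the root is kept; and adjacency of the bags
    of i and j when [Q i j] holds.  When [Q i j] fails the roots themselves are
    adjacent and nothing is required. *)
Definition linkage (X : I -> {set I}) : Prop :=
  [/\ forall i j k, k \in X i -> k \in X j -> i = j,
      forall i, X i != set0 -> exists2 k, k \in X i & Q i k
    & forall i j, Q i j ->
        [\/ exists2 k, k \in X i & Q k j,
            exists2 l, l \in X j & Q i l
          | exists k l, [/\ k \in X i, l \in X j & Q k l]]].

Lemma certificate_linkage (H : graph {x | x \in roots}) bag :
  (forall s t, H s t = (s != t)) -> rooted_certificate doubling H bag ->
  exists X, linkage X.
Proof.
move=> Hcomplete [disj rooted conn linked].
have bag_inj i j x : x \in bag (root i) -> x \in bag (root j) -> i = j.
  move=> xi xj; apply: (can_inj rootK); apply/eqP.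
  by apply: contraLR xi => /disj/disjointFl->.
have root_bag i j : (false, j) \in bag (root i) -> j = i.
  by apply: bag_inj; apply: (rooted (root j)).
exists (fun i => [set k | (true, k) \in bag (root i)]); split=> [i j k|i|i j].
- by rewrite !inE; apply: bag_inj.
- case/set0Pn=> k; rewrite inE => ki.
  have /connectP[p] := conn _ _ _ (rooted (root i)) ki.
  case: p => [_ [] //|[b l] p /= /andP[/and3P[_ li adj_il] _] _].
  case: b li adj_il => [li Qil|/root_bag->]; last first.
    by rewrite /= doubling_irrefl.
  by exists l; rewrite ?inE.
- move=> Qij; have neq_ij : i != j.
    by apply: contraTneq Qij => ->; rewrite adj_irrefl.
  have [|[b k] [[c l] []]] := linked (root i) (root j).
    by rewrite Hcomplete (inj_eq (can_inj rootK)).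
  case: b => [ki|/root_bag->]; case: c => [lj|/root_bag->];
    rewrite /= /doubling_adj /= => Qkl.
  + by constructor 3; exists k, l; rewrite !inE.
  + by constructor 1; exists k; rewrite ?inE.
  + by constructor 2; exists l; rewrite ?inE.
  + by rewrite Qij andbF in Qkl.
Qed.

Definition nbrs (S : {set I}) : {set I} := [set j | [exists i in S, Q i j]].

Definition triangle_free : Prop := forall i j k, Q i j -> Q j k -> ~~ Q i k.

Definition expanding : Prop :=
  forall S : {set I}, S != set0 -> anticlique Q S -> #|S| < #|nbrs S|.

(** A bag without copies forces two copies into the bag of each neighbor, and
    expansion makes this cost more copies than the empty bags save. *)
Lemma linkage_nonempty X :
  triangle_free -> expanding -> linkage X -> forall i, X i != set0.
Proof.
move=> no_triangle expand [disj attached covered].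
pose S := [set i | X i == set0].
have cross i j : i \in S -> Q i j -> exists2 k, k \in X j & Q i k.
  rewrite inE => /eqP Xi0 /covered[] [] k; rewrite ?Xi0 ?inE //.
    by exists k.
  by case=> l [].
have big_nbr j : j \in nbrs S -> 1 < #|X j|.
  rewrite inE => /exists_inP[i Si Qij].
  have [k kj Qik] := cross i j Si Qij.
  have [|l lj Qjl] := attached j; first by apply/set0Pn; exists k.
  rewrite (cardD1 k) (cardD1 l) kj !inE lj andbT.
  suff -> : l != k by [].
  by apply: contraTneq Qik => <-; apply: no_triangle Qjl.
have stableS : anticlique Q S.
  move=> i j Si; rewrite inE => /eqP Xj0; apply/negP=> /(cross _ _ Si)[k].
  by rewrite Xj0 inE.
have few : \sum_j #|X j| <= #|I|.
  rewrite -sum1_card -(eq_bigr _ (fun j _ => sum1_card (mem (X j)))).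
  rewrite (exchange_big_dep xpredT) //=; apply: leq_sum => k _.
  rewrite sum1_card; apply/card_le1_eqP=> i j ki kj.
  exact: (disj j i k kj ki).
have many : #|~: S| + #|nbrs S| <= \sum_j #|X j|.
  rewrite -!sum1_card big_mkcond /= [X in _ + X <= _]big_mkcond -big_split /=.
  apply: leq_sum => j _; rewrite in_setC [j \in S]inE -card_gt0.
  by case: (boolP (j \in nbrs S)) => [/big_nbr|_]; case: #|X j| => [|[]].
move=> i; apply/negP=> Xi0.
have Sn0 : S != set0 by apply/set0Pn; exists i; rewrite inE.
have := leq_trans many few; rewrite -(cardsC S) addnC leq_add2r.
by rewrite leqNgt expand.
Qed.

Lemma linkage_map X :
  triangle_free -> expanding -> linkage X ->
  exists p : I -> I, [/\ injective p, forall i, Q i (p i)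
    & forall i j, Q i j -> [|| Q (p i) j, Q i (p j) | Q (p i) (p j)]].
Proof.
move=> no_triangle expand linkX.
have nonempty := linkage_nonempty no_triangle expand linkX.
case: linkX => disj attached covered.
have pick i : exists k, (k \in X i) && Q i k.
  by have [k ki Qik] := attached i (nonempty i); exists k; rewrite ki.
pose p i := xchoose (pick i).
have pX i : p i \in X i by case/andP: (xchooseP (pick i)).
have pQ i : Q i (p i) by case/andP: (xchooseP (pick i)).
have p_inj : injective p.
  by move=> i j eq_p; apply: (disj i j (p i)) => //; rewrite eq_p.
(* As [p] is onto, each copy is the chosen copy of some bag, and so of the only
   bag that contains it. *)
have Xp i k : k \in X i -> k = p i.
  have [q _ qK] := injF_bij p_inj.
  by rewrite -(qK k) => /(disj _ _ _ (pX _))->.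
exists p; split=> // i j /covered[].
- by case=> k /Xp-> ->.
- by case=> k /Xp-> ->; rewrite orbT.
- by case=> k [l [/Xp-> /Xp-> ->]]; rewrite !orbT.
Qed.

End Doubling.

(** * The theta graph *)

(** The pentagon 0-1-2-3-4 with the ear 0-5-6-2. *)
Definition theta_nbrs : seq (seq nat) :=
  [:: [:: 1; 4; 5]; [:: 0; 2]; [:: 1; 3; 6]; [:: 2; 4]; [:: 0; 3];
      [:: 0; 6]; [:: 2; 5]].

Definition theta_adj : rel 'I_7 :=
  [rel i j : 'I_7 | (j : nat) \in nth [::] theta_nbrs i].

Lemma theta_sym : symmetric theta_adj.
Proof.
by move=> [[|[|[|[|[|[|[|]]]]]]] // ?] [[|[|[|[|[|[|[|]]]]]]] // ?].
Qed.

Lemma theta_irrefl : irreflexive theta_adj.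
Proof. by move=> [[|[|[|[|[|[|[|]]]]]]] // ?]. Qed.

Definition theta : graph 'I_7 := Graph theta_sym theta_irrefl.

Lemma thetaE i j : theta i j = ((j : nat) \in nth [::] theta_nbrs i).
Proof. by []. Qed.

Lemma theta_triangle_free : triangle_free theta.
Proof. by do 3!move=> [[|[|[|[|[|[|[|]]]]]]] // ?]. Qed.

Lemma card_count_inord n (A : {set 'I_n.+1}) :
  #|A| = count (fun k => inord k \in A) (iota 0 n.+1).
Proof.
rewrite cardE /enum_mem size_filter -enumT -val_enum_ord count_map.
by apply: eq_count => i /=; rewrite inord_val.
Qed.

Lemma mem_nbrs_theta (S : {set 'I_7}) k :
  k < 7 -> (inord k \in nbrs theta S) =
           has (fun l => inord l \in S) (nth [::] theta_nbrs k).
Proof.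
move=> k_lt7; rewrite inE; apply/exists_inP/hasP=> [[i iS]|[l]].
  rewrite adj_sym thetaE inordK // => ik.
  by exists (i : nat); rewrite ?inord_val.
have [l_lt7 lk lS|] := ltnP l 7.
  by exists (inord l); rewrite // adj_sym thetaE !inordK.
case: k k_lt7 => [|[|[|[|[|[|[|]]]]]]] //= _.
all: by case: l => [|[|[|[|[|[|[|]]]]]]].
Qed.

Lemma theta_expanding : expanding theta.
Proof.
move=> S; rewrite -card_gt0 => Sn0 stableS.
have disjS k : (inord k \in S) && (inord k \in nbrs theta S) = false.
  apply/andP=> -[kS]; rewrite inE => /exists_inP[j jS Qjk].
  by have := stableS _ _ jS kS; rewrite Qjk.
(* Each edge of the graph has an end in {0, 2, 3, 5}. *)
move: Sn0 (disjS 0) (disjS 2) (disjS 3) (disjS 5).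
rewrite !card_count_inord /= !mem_nbrs_theta //=.
move: (inord 0 \in S) (inord 1 \in S) (inord 2 \in S) (inord 3 \in S)
      (inord 4 \in S) (inord 5 \in S) (inord 6 \in S).
by do 7!case.
Qed.

(** Of the 288 maps that move every vertex along an edge, the injective ones
    rotate a pentagon and swap the other two vertices; each of them fails the
    adjacency condition at the edge 04 or at the edge 05. *)
Lemma theta_no_map (p : 'I_7 -> 'I_7) :
  injective p -> (forall i, theta i (p i)) ->
  ~ forall i j, theta i j ->
      [|| theta (p i) j, theta i (p j) | theta (p i) (p j)].
Proof.
move=> p_inj pQ pcov.
pose q k : nat := p (inord k).
have qQ k : k < 7 -> q k \in nth [::] theta_nbrs k.
  by move=> k_lt7; have := pQ (inord k); rewrite thetaE inordK.
have q_uniq : uniq [seq q k | k <- iota 0 7].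
  rewrite map_inj_in_uniq ?iota_uniq // => k l; rewrite !mem_iota => k_lt l_lt.
  by move/val_inj/p_inj/(congr1 val); rewrite /= !inordK.
have qcov k l : k < 7 -> l < 7 -> l \in nth [::] theta_nbrs k ->
    [|| l \in nth [::] theta_nbrs (q k), q l \in nth [::] theta_nbrs k
      | q l \in nth [::] theta_nbrs (q k)].
  move=> k_lt l_lt kl; have := pcov (inord k) (inord l).
  by rewrite !thetaE !inordK //; apply.
move: q_uniq (qcov 0 4 isT isT isT) (qcov 0 5 isT isT isT).
move: (qQ 0 isT) (qQ 1 isT) (qQ 2 isT) (qQ 3 isT) (qQ 4 isT) (qQ 5 isT)
      (qQ 6 isT).
rewrite /=.
move: (q 0) (q 1) (q 2) (q 3) (q 4) (q 5) (q 6) => q0 q1 q2 q3 q4 q5 q6.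
rewrite !in_cons !in_nil !orbF.
by do ![case/or3P=> /eqP-> | case/orP=> /eqP->].
Qed.

Theorem theorem2 : ~ property_star (complete_graph 7).
Proof.
move=> star.
pose H := routing_graph (doubling theta) (fibres _) (roots _).
have Hcomplete : forall s t, H s t = (s != t) by exact: routing_doubling.
have [bag cert] : exists bag, rooted_certificate (doubling theta) H bag.
  apply: (star _ _ (fibres 'I_7)).
  - exact: fibres_coloring.
  - exact: card_fibres.
  - exact: roots_transversal.
  - by [].
  - exists (fun s => (val s).2).
      by exists (@root _); [exact: root_indexK | exact: rootK].
    by move=> s t; rewrite Hcomplete /= (inj_eq (can_inj (@root_indexK _))).
have [X linkX] := certificate_linkage Hcomplete cert.
have [p [p_inj pQ pcov]] :=
  linkage_map theta_triangle_free theta_expanding linkX.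
exact: theta_no_map p_inj pQ pcov.
Qed.
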